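(* For every non-negative integer $b$, the class of lattice path matroids of branch-width at most $b$ is well-quasi-ordered under the minor relation; that is, for every infinite sequence $M_1, M_2, \ldots$ of lattice path matroids each of branch-width at most $b$, there exist indices $i<j$ such that $M_i$ is isomorphic to a minor of $M_j$.
   Context: A lattice path is a word in the alphabet $\{E,N\}$, read as a path in $\mathbb{Z}^2$ starting at $(0,0)$ with East steps $E=(1,0)$ and North steps $N=(0,1)$. Let $P=p_1\cdots p_{m+r}$ and $Q=q_1\cdots q_{m+r}$ be lattice paths from $(0,0)$ to $(m,r)$ such that $P$ never goes above $Q$ (for every $i$, the first $i$ steps of $P$ contain at most as many North steps as the first $i$ steps of $Q$). Let $u_1<\dots<u_r$ be the positions of the North steps of $P$ and $l_1<\dots<l_r$ the positions of the North steps of $Q$, and let $N_i=\{l_i,l_i+1,\ldots,u_i\}$. Then $M[P,Q]$ is the transversal matroid on ground set $[m+r]=\{1,\ldots,m+r\}$ with presentation $(N_i : i\in[r])$. A lattice path matroid is a matroid isomorphic to $M[P,Q]$ for some such pair $P,Q$. Branch-width is the usual branch-width of matroids: the minimum over all branch-decompositions (cubic trees whose leaves are labelled bijectively by the ground set) of the maximum, over edges of the tree, of $\lambda_M(X)=r(X)+r(E(M)-X)-r(M)+1$, where $(X,E(M)-X)$ is the partition of $E(M)$ displayed by the edge; matroids with at most one element have branch-width at most $1$ by convention. *)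

(* Defs.v *)
From HB Require Import structures.
From mathcomp Require Import all_boot.

Set Implicit Arguments.
Unset Strict Implicit.
Unset Printing Implicit Defensive.

Record matroid := Matroid {
  ground :> finType;
  indep : pred {set ground};
  indep0 : indep set0;
  indepS : forall I J : {set ground}, I \subset J -> indep J -> indep I;
  indep_aug : forall I J : {set ground}, indep I -> indep J -> #|I| < #|J| ->
    exists2 x, x \in J :\: I & indep (x |: I)
}.

Definition rank (M : matroid) (X : {set M}) : nat :=
  \max_(I : {set M} | indep I && (I \subset X)) #|I|.

Definition isomorphic (M N : matroid) : Prop :=
  exists2 f : M -> N, bijective f & forall X : {set M}, indep (f @: X) = indep X.

Section RankTheory.
Variable M : matroid.
Implicit Types X Y I J B C : {set M}.

Lemma indep_rank I X : indep I -> I \subset X -> #|I| <= rank X.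
Proof.
move=> iI sIX; rewrite /rank.
by apply: (@leq_bigmax_cond _ _ (fun I : {set M} => #|I|)); rewrite iI.
Qed.

Lemma rank_witness X : exists I, [/\ indep I, I \subset X & #|I| = rank X].
Proof.
have P0 : indep (set0 : {set M}) && (set0 \subset X) by rewrite indep0 sub0set.
rewrite /rank (bigmax_eq_arg set0 P0); case: arg_maxnP => // I /andP[iI sI] _.
by exists I.
Qed.

Lemma indep_extend I X : indep I -> I \subset X ->
  exists J, [/\ indep J, I \subset J, J \subset X & #|J| = rank X].
Proof.
have [n] := ubnP (rank X - #|I|); elim: n I => // n IHn I lt_n iI sIX.
have [lt_I|ge_I] := ltnP #|I| (rank X); last first.
  by exists I; split=> //; apply/eqP; rewrite eqn_leq indep_rank.
have [K [iK sKX cK]] := rank_witness X.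
have [|x /setDP[xK xI] ixI] := indep_aug iI iK; first by rewrite cK.
have sxIX : x |: I \subset X by rewrite subUset sub1set (subsetP sKX).
have [|J [iJ sJ sJX cJ]] := IHn _ _ ixI sxIX.
  rewrite cardsU1 xI add1n -ltnS; apply: leq_trans lt_n.
  by rewrite ltnS ltn_sub2l.
by exists J; split=> //; apply: subset_trans sJ; apply: subsetUr.
Qed.

Lemma rank_contractE B C X : indep B -> B \subset C -> #|B| = rank C ->
  [disjoint X & C] -> (rank (X :|: C) == #|X| + rank C) = indep (X :|: B).
Proof.
move=> iB sBC cB dXC.
have dXB : [disjoint X & B] by apply: disjointWr dXC.
have cXB : #|X :|: B| = #|X| + rank C.
  by rewrite cardsU (disjoint_setI0 dXB) cards0 subn0 cB.
have sXB : X :|: B \subset X :|: C by apply: setUS.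
have [J [iJ sBJ sJ cJ]] := indep_extend iB (subset_trans sBC (subsetUr X C)).
have sJXB : J \subset X :|: B.
  have sBJC : B \subset J :&: C by rewrite subsetI sBJ.
  have /eqP eB : B == J :&: C.
    rewrite eqEcard sBJC cB indep_rank ?subsetIr //.
    by apply: indepS iJ; apply: subsetIl.
  apply/subsetP=> x xJ; rewrite eB !inE xJ /=.
  by have := subsetP sJ x xJ; rewrite inE.
apply/eqP/idP => [eqr | iXB].
  suff -> : X :|: B = J by [].
  by apply/esym/eqP; rewrite eqEcard sJXB cXB cJ eqr leqnn.
apply/eqP; rewrite eqn_leq -cXB indep_rank // andbT -cJ.
exact: subset_leq_card.
Qed.

End RankTheory.

(* The minor M / C \ D.  [C] and [D] are meant to be disjoint. *)
Section Minor.
Variables (M : matroid) (C D : {set M}).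

Definition minor_ground : finType := {x : M | x \notin C :|: D}.

Definition minor_indep (X : {set minor_ground}) : bool :=
  rank (val @: X :|: C) == #|X| + rank C.

Lemma minor_indepE : exists B : {set M}, [disjoint val @: [set: minor_ground] & B]
  /\ forall X, minor_indep X = indep (val @: X :|: B).
Proof.
have dC (X : {set minor_ground}) : [disjoint val @: X & C].
  rewrite disjoints_subset; apply/subsetP=> _ /imsetP[x _ ->].
  by have := valP x; rewrite !inE => /norP[].
have [B [iB sBC cB]] := rank_witness C.
exists B; split=> [|X]; first exact: disjointWr (dC _).
rewrite /minor_indep -(card_imset (mem X) val_inj).
exact: rank_contractE (dC _).
Qed.

Lemma minor_indep0 : minor_indep set0.
Proof. by rewrite /minor_indep imset0 set0U cards0. Qed.

Lemma minor_indepS (I J : {set minor_ground}) :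
  I \subset J -> minor_indep J -> minor_indep I.
Proof.
have [B [_ E]] := minor_indepE; rewrite !E => sIJ.
by apply: indepS; apply: setSU; apply: imsetS.
Qed.

Lemma minor_indep_aug (I J : {set minor_ground}) :
  minor_indep I -> minor_indep J -> #|I| < #|J| ->
  exists2 x, x \in J :\: I & minor_indep (x |: I).
Proof.
have [B [dB E]] := minor_indepE; rewrite !E => iI iJ ltIJ.
have cU (X : {set minor_ground}) : #|val @: X :|: B| = #|X| + #|B|.
  have dXB : [disjoint val @: X & B].
    by apply: disjointWl dB; apply: imsetS; apply: subsetT.
  by rewrite cardsU (disjoint_setI0 dXB) cards0 subn0 card_imset //; apply: val_inj.
have [|x /setDP[]] := indep_aug iI iJ; first by rewrite !cU ltn_add2r.
rewrite !inE negb_or => /orP[/imsetP[y yJ ->{x}]|->]; last by rewrite andbF.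
rewrite (mem_imset _ _ val_inj) => /andP[yI _] iy.
by exists y; rewrite ?inE ?yI // E imsetU1 -setUA.
Qed.

Definition minor : matroid :=
  Matroid minor_indep0 minor_indepS minor_indep_aug.

End Minor.

Definition isomorphic_to_minor (N M : matroid) : Prop :=
  exists C D : {set M}, [disjoint C & D] /\ isomorphic N (minor C D).

(* The transversal matroid with presentation [A]: its independent sets are the
   partial transversals of [A].  The [option] only serves to keep the empty set
   a partial transversal when there are no indices. *)
Section Transversal.
Variables (T I : finType) (A : I -> {set T}).

Definition matches (X : {set T}) (f : {ffun T -> option I}) : bool :=
  dinjectiveb f (mem X)
  && [forall x in X, exists i, (f x == Some i) && (x \in A i)].

Definition partial_transversal (X : {set T}) : bool :=
  [exists f : {ffun T -> option I}, matches X f].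

Lemma partial_transversal0 : partial_transversal set0.
Proof.
apply/existsP; exists [ffun=> None]; apply/andP; split.
  by apply/dinjectiveP=> x y; rewrite inE.
by apply/forall_inP=> x; rewrite inE.
Qed.

Lemma partial_transversalS (X Y : {set T}) :
  X \subset Y -> partial_transversal Y -> partial_transversal X.
Proof.
move=> /subsetP sXY /existsP[f /andP[/dinjectiveP injf /forall_inP fA]].
apply/existsP; exists f; apply/andP; split.
  by apply/dinjectiveP=> x y xX yX; apply: injf; apply: sXY.
by apply/forall_inP=> x xX; apply/fA/sXY.
Qed.

Lemma partial_transversal_aug (X Y : {set T}) :
  partial_transversal X -> partial_transversal Y -> #|X| < #|Y| ->
  exists2 x, x \in Y :\: X & partial_transversal (x |: X).
Proof.
move=> /existsP[f mf] /existsP[g /andP[/dinjectiveP injg /forall_inP gA]] ltXY.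
have [n] := ubnP (#|X| - #|[set x in X | f x == g x]|).
elim: n f mf => // n IHn f /andP[/dinjectiveP injf /forall_inP fA] lt_n.
have [y yY gyX] : exists2 y, y \in Y & g y \notin f @: X.
  apply/exists_inP; rewrite -negb_forall_in; apply: contraL ltXY => /forall_inP gY.
  rewrite -leqNgt -(card_in_imset injg) -(card_in_imset injf).
  by apply/subset_leq_card/subsetP=> _ /imsetP[y yY ->]; apply: gY.
pose f' := [ffun x => if x == y then g y else f x].
have mf' : matches (y |: X) f'.
  have fNg x : x \in X -> f x <> g y.
    by move=> xX eq_fg; case/negP: gyX; rewrite -eq_fg imset_f.
  apply/andP; split.
    apply/dinjectiveP=> a c; rewrite !inE !ffunE.
    have [-> _|_ /= aX] := eqVneq a y; have [-> _|_ /= cX] := eqVneq c y => //.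
    - by move/esym/fNg; case.
    - by move/fNg; case.
    - exact: injf.
  apply/forall_inP=> a; rewrite !inE ffunE.
  by have [-> _|_ /= aX] := eqVneq a y; [apply: gA | apply: fA].
have [yX|yNX] := boolP (y \in X); last first.
  by exists y; [rewrite inE yNX | apply/existsP; exists f'].
rewrite (setUidPr _) ?sub1set // in mf'.
apply: (IHn f' mf'); rewrite -ltnS; apply: leq_trans lt_n; rewrite ltnS.
set a := [set x in X | f x == g x]; set a' := [set x in X | f' x == g x].
have ltaa' : a \proper a'.
  apply/properP; split.
    apply/subsetP=> x; rewrite !inE ffunE => /andP[-> fx] /=.
    by have [->|] := eqVneq x y.
  exists y; rewrite !inE yX ?ffunE ?eqxx //=.
  by apply: contra gyX => /eqP <-; apply: imset_f.
apply: ltn_sub2l (proper_card ltaa'); apply: leq_trans (proper_card ltaa') _.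
by apply/subset_leq_card/subsetP=> x; rewrite inE => /andP[].
Qed.

Definition transversal_matroid : matroid :=
  Matroid partial_transversal0 partial_transversalS partial_transversal_aug.

End Transversal.

Definition East := false.
Definition North := true.

Definition is_lattice_path (m r : nat) (P : (m + r).-tuple bool) : Prop :=
  count_mem North P = r.

Definition never_above (m r : nat) (P Q : (m + r).-tuple bool) : Prop :=
  forall i, count_mem North (take i P) <= count_mem North (take i Q).

(* Steps are numbered from 0, so that the ground set is ['I_(m + r)]. *)
Definition north_positions (P : seq bool) : seq nat :=
  [seq k <- iota 0 (size P) | nth East P k == North].

Definition lpm_interval (m r : nat) (P Q : (m + r).-tuple bool) (i : 'I_r) :
    {set 'I_(m + r)} :=
  [set x : 'I_(m + r) |
    nth 0 (north_positions Q) i <= x <= nth 0 (north_positions P) i].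

Definition lpm (m r : nat) (P Q : (m + r).-tuple bool) : matroid :=
  transversal_matroid (lpm_interval P Q).

Definition lattice_path_matroid (M : matroid) : Prop :=
  exists (m r : nat) (P Q : (m + r).-tuple bool),
    [/\ is_lattice_path P, is_lattice_path Q, never_above P Q
      & isomorphic M (lpm P Q)].

(* The truncated subtraction is harmless: rank X + rank (~: X) >= rank setT. *)
Definition lambda (M : matroid) (X : {set M}) : nat :=
  (rank X + rank (~: X) - rank [set: M]) + 1.

Definition is_tree (V : finType) (e : rel V) : Prop :=
  [/\ 0 < #|V|, symmetric e, irreflexive e,
      forall x y, connect e x y
    & forall c : seq V, 2 < size c -> ~ ucycle e c].

Definition degree (V : finType) (e : rel V) (x : V) : nat := #|[set y | e x y]|.

Definition is_cubic (V : finType) (e : rel V) : Prop :=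
  forall x, degree e x = 1 \/ degree e x = 3.

Record branch_decomposition (M : matroid) := BranchDecomposition {
  bd_vertex : finType;
  bd_edge : rel bd_vertex;
  bd_tree : is_tree bd_edge;
  bd_cubic : is_cubic bd_edge;
  bd_leaf : M -> bd_vertex;
  bd_leaf_inj : injective bd_leaf;
  bd_leafP : forall v, degree bd_edge v = 1 <-> exists x, bd_leaf x = v
}.

Section Width.
Variables (M : matroid) (B : branch_decomposition M).

Definition del_edge (u v : bd_vertex B) : rel (bd_vertex B) :=
  [rel x y | [&& bd_edge x y, (x, y) != (u, v) & (x, y) != (v, u)]].

(* The labels on the side of [u] in the partition displayed by the edge uv. *)
Definition displayed (u v : bd_vertex B) : {set M} :=
  [set x | connect (del_edge u v) u (bd_leaf B x)].

Definition width : nat :=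
  \max_(uv : bd_vertex B * bd_vertex B | bd_edge uv.1 uv.2)
     lambda (displayed uv.1 uv.2).

End Width.

(* A matroid with at most one element has no branch-decomposition; by
   convention its branch-width is taken to be 0. *)
Definition branch_width_at_most (b : nat) (M : matroid) : Prop :=
  #|M| <= 1 \/ exists B : branch_decomposition M, width B <= b.

(* Main.v *)
Require Import Defs.
From mathcomp Require Import all_boot boolp zify.

Set Implicit Arguments.
Unset Strict Implicit.
Unset Printing Implicit Defensive.

(** A lattice path matroid is given by its two bounding paths, read together as
    one word of pairs of steps. The proof combines two facts about the gap
    between the paths, that is, the difference of their heights.

    Bounded branch-width bounds the gap. If the gap at some position is [k], then
    a [k] by [k] square fits between the paths there, so contracting and deleting
    everything outside the [2k] positions around it leaves the uniform matroid of
    rank [k] on [2k] elements ([lpm_window]). A branch-decomposition has an edge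
    with a third of these elements on each side ([balanced_edge]), and the
    separation that it displays has order proportional to [k]
    ([window_lambda]).

    Words of bounded gap are well-quasi-ordered. Take a factor of the word that
    starts and ends at the same gap and never goes below that gap. Contracting
    the North steps of the lower path in this factor and deleting its other
    elements amounts to removing the factor from the word. Indeed, a path that
    copies the steps of the lower path throughout the factor stays in the region,
    whatever its height on entry. Removing such factors defines a
    relation on words that implies the minor relation ([shrinking_minor]), the
    proof of which is arithmetic thanks to a description of the independent sets
    by Hall's condition for segments ([lpm_indepP]). Cutting a word at its
    returns to gap zero writes it as a list of flat steps and bumps, and the
    interior of a bump has a smaller maximal gap; so Higman's lemma ([higman]),
    applied once for each value of the gap, gives the theorem ([wqo_dyck]). *)

(** * Higman's lemma *)

Definition wqo_on (A : Type) (S : A -> Prop) (R : A -> A -> Prop) : Prop :=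
  forall a : nat -> A, (forall i, S (a i)) -> exists i j, i < j /\ R (a i) (a j).

(** Only finitely many terms can fail to be below a later one, since those that
    fail form a bad sequence; beyond them, one can always move up. *)
Lemma ascending_subsequence (A : Type) (S : A -> Prop) (R : A -> A -> Prop)
    (a : nat -> A) :
  (forall y x z, R x y -> R y z -> R x z) -> wqo_on S R -> (forall i, S (a i)) ->
  exists2 phi : nat -> nat, {homo phi : i j / i < j} &
    forall i j, i < j -> R (a (phi i)) (a (phi j)).
Proof.
move=> Rtrans wqoR Sa.
have [N climb] : exists N, forall i, N <= i -> exists j, i < j /\ R (a i) (a j).
  apply: contrapT => /forallNP noN.
  have /choice[g gP] : forall N, exists i,
      N <= i /\ (forall j, i < j -> ~ R (a i) (a j)).
    move=> N; have /existsNP[i /not_implyP[le_Ni /forallNP stuck]] := noN N.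
    by exists i; split=> // j lt_ij Rij; apply: (stuck j).
  pose k n := iter n (fun i => g i.+1) (g 0).
  have kmono : {homo k : i j / i < j}.
    by apply: homo_ltn => [|i]; [exact: ltn_trans | case: (gP (k i).+1)].
  have [i [j [lt_ij]]] := wqoR (fun n => a (k n)) (fun n => Sa _).
  suff stuck : forall j', k i < j' -> ~ R (a (k i)) (a j').
    exact: stuck (kmono _ _ lt_ij).
  by case: (i) => [|i'] /=; [case: (gP 0) | case: (gP (k i').+1)].
have /choice[h hP] : forall i, exists j, N <= i -> i < j /\ R (a i) (a j).
  move=> i; have [le_Ni|] := leqP N i; last by exists 0.
  by have [j ?] := climb i le_Ni; exists j.
pose phi n := iter n h N.
have leN n : N <= phi n.
  by elim: n => //= n IHn; case: (hP _ IHn) => lt_h _; lia.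
by exists phi; apply: homo_ltn => [|i];
  [exact: ltn_trans | case: (hP _ (leN i)) | | case: (hP _ (leN i))].
Qed.

Inductive list_emb (A : Type) (R : A -> A -> Prop) : seq A -> seq A -> Prop :=
| emb_nil : list_emb R [::] [::]
| emb_skip x s t : list_emb R s t -> list_emb R s (x :: t)
| emb_cons x y s t : R x y -> list_emb R s t -> list_emb R (x :: s) (y :: t).

Lemma emb_nil_l (A : Type) (R : A -> A -> Prop) s : list_emb R [::] s.
Proof. by elim: s => [|x s]; constructor. Qed.

Fixpoint all_in (A : Type) (S : A -> Prop) (s : seq A) : Prop :=
  if s is x :: s' then S x /\ all_in S s' else True.

Section MinimalBad.
Variables (A : Type) (S : A -> Prop) (R : A -> A -> Prop).

Let bad (s : nat -> seq A) : Prop :=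
  (forall i, all_in S (s i)) /\ forall i j, i < j -> ~ list_emb R (s i) (s j).

Let agree n (s t : nat -> seq A) : Prop := forall i, i < n -> s i = t i.

Let minimal_at n (s : nat -> seq A) : Prop :=
  forall t, bad t -> agree n s t -> size (s n) <= size (t n).

Lemma bad_improve s n : bad s ->
  exists t, [/\ bad t, agree n s t & minimal_at n t].
Proof.
move=> bs; have [k] := ubnP (size (s n)); elim: k => // k IHk in s bs * => lt_k.
have [min_s|] := pselect (minimal_at n s); first by exists s; split.
case/existsNP=> t /not_implyP[bt /not_implyP[st /negP]]; rewrite -ltnNge => lt_ts.
have [|t' [bt' tt' mt']] := IHk t bt; first exact: leq_trans lt_ts _.
by exists t'; split=> // i lt_in; rewrite st // tt'.
Qed.

(** The sequence is built by improving a bad sequence at positions 0, 1, 2, ...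
    in turn; its term at n is settled by the n-th improvement. *)
Lemma minimal_bad : (exists s, bad s) ->
  exists2 w, bad w & forall n, minimal_at n w.
Proof.
case=> s0 bad0.
have /choice[f fP] : forall ns : nat * (nat -> seq A), exists t,
    bad ns.2 -> [/\ bad t, agree ns.1 ns.2 t & minimal_at ns.1 t].
  move=> [n s]; have [/(@bad_improve _ n)[t tP]|Nbs] := pselect (bad s).
    by exists t.
  by exists s.
pose g := fix g n := if n is m.+1 then f (m, g m) else s0.
have bad_g n : bad (g n) by elim: n => //= n /(fP (n, _))[].
have gS n : agree n (g n) (g n.+1) by have [] := fP (n, g n) (bad_g n).
have g_le n m : n <= m -> agree n (g n) (g m).
  elim: m => [|m IHm]; first by rewrite leqn0 => /eqP->.
  rewrite leq_eqVlt => /predU1P[-> //|le_nm] i lt_in; rewrite IHm // gS //.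
  exact: leq_trans lt_in le_nm.
pose w n := g n.+1 n.
have wE n i : i < n -> w i = g n i by move=> lt_in; apply: (g_le i.+1).
exists w => [|n t bt wt].
  split=> [i | i j lt_ij]; first by case: (bad_g i.+1) => Sg _; apply: Sg.
  by rewrite (wE j.+1) 1?ltnW // (wE j.+1) //; case: (bad_g j.+1) => _; apply.
have [_ _ mg] := fP (n, g n) (bad_g n).
by apply: mg => // i lt_in; rewrite -wt // (wE n.+1) // ltnW.
Qed.

End MinimalBad.

(** In a minimal bad sequence, take the terms whose heads ascend: replacing
    them by their tails gives a smaller sequence, which is good, and adding the
    heads back makes the minimal sequence itself good. *)
Lemma higman (A : Type) (S : A -> Prop) (R : A -> A -> Prop) :
  (forall y x z, R x y -> R y z -> R x z) -> wqo_on S R ->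
  wqo_on (all_in S) (list_emb R).
Proof.
move=> Rtrans wqoR s0 S0; apply: contrapT => bad0.
have [|w [Sw bw] minw] := @minimal_bad A S R.
  exists s0; split=> // i j lt_ij Rij; apply: bad0; by exists i, j.
have /choice[a aP] : forall n, exists a, exists v, w n = a :: v.
  move=> n; case Ew: (w n) => [|x v]; last by exists x, v.
  by case: (bw n n.+1) => //; rewrite Ew; apply: emb_nil_l.
have /choice[v vP] : forall n, exists v, w n = a n :: v by [].
have [Sa Sv] : (forall n, S (a n)) /\ forall n, all_in S (v n).
  by split=> n; have:= Sw n; rewrite vP => -[].
have [phi phi_mono phiR] := ascending_subsequence Rtrans wqoR Sa.
have le_phi i : phi 0 <= phi i by case: i => // i; apply/ltnW/phi_mono.
pose t n := if n < phi 0 then w n else v (phi (n - phi 0)).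
suff: size (w (phi 0)) <= size (t (phi 0)).
  by rewrite /t ltnn subnn vP /= ltnn.
apply: minw => [|i lt_i]; last by rewrite /t lt_i.
split=> [i | i j lt_ij]; rewrite /t; first by case: ifP.
case: ltnP => [lt_i|le_i]; case: ltnP => [lt_j|le_j] Rij.
- exact: bw Rij.
- apply: (bw i (phi (j - phi 0))); first exact: leq_trans lt_i (le_phi _).
  by rewrite (vP (phi _)); constructor.
- lia.
- have lt_ij' : i - phi 0 < j - phi 0 by lia.
  apply: (bw _ _ (phi_mono _ _ lt_ij')); rewrite !vP.
  by constructor=> //; apply: phiR.
Qed.

(** * Pairs of paths as words *)

Definition norths (s : seq bool) (i : nat) : nat := count_mem North (take i s).

Lemma norths0 s : norths s 0 = 0.
Proof. by rewrite /norths take0. Qed.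

Lemma northsS s i : norths s i.+1 = norths s i + nth false s i.
Proof.
rewrite /norths; have [lt_i|le_i] := ltnP i (size s).
  by rewrite (take_nth false) // -cats1 count_cat /= addn0; case: (nth _ _ _).
by rewrite nth_default // !take_oversize ?addn0 // ltnW.
Qed.

Lemma norths_cons b s i : norths (b :: s) i.+1 = b + norths s i.
Proof. by rewrite /norths /=; case: b. Qed.

Lemma norths_catl s t i : i <= size s -> norths (s ++ t) i = norths s i.
Proof. by move=> le_i; rewrite /norths takel_cat. Qed.

Lemma norths_catr s t i :
  norths (s ++ t) (size s + i) = norths s (size s) + norths t i.
Proof.
rewrite /norths take_cat ltnNge leq_addr addKn count_cat take_size.
by [].
Qed.

Lemma norths_steps s i j : i <= j ->
  norths s i <= norths s j <= norths s i + (j - i).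
Proof.
elim: j => [|j IHj]; first by rewrite leqn0 => /eqP->; rewrite subnn addn0 leqnn.
rewrite leq_eqVlt => /predU1P[->|]; first by rewrite subnn addn0 leqnn.
rewrite ltnS => le_ij; have := IHj le_ij; rewrite northsS.
by case: (nth _ _ _); lia.
Qed.

(** The pair of paths P, Q is the word whose i-th letter is the pair of the
    i-th steps, so its lower path is P and its upper path is Q. *)
Definition word := seq (bool * bool).

Definition lower (w : word) : nat -> nat := norths (unzip1 w).
Definition upper (w : word) : nat -> nat := norths (unzip2 w).

Definition letter (w : word) (i : nat) : bool * bool := nth (East, East) w i.

Lemma lowerS w i : lower w i.+1 = lower w i + (letter w i).1.
Proof.
rewrite /lower northsS /letter; congr (_ + nat_of_bool _).
have [lt_i|le_i] := ltnP i (size w); first exact: nth_map.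
by rewrite !nth_default ?size_map.
Qed.

Lemma upperS w i : upper w i.+1 = upper w i + (letter w i).2.
Proof.
rewrite /upper northsS /letter; congr (_ + nat_of_bool _).
have [lt_i|le_i] := ltnP i (size w); first exact: nth_map.
by rewrite !nth_default ?size_map.
Qed.

Lemma lower0 w : lower w 0 = 0. Proof. exact: norths0. Qed.
Lemma upper0 w : upper w 0 = 0. Proof. exact: norths0. Qed.

Lemma lower_cons l w i : lower (l :: w) i.+1 = l.1 + lower w i.
Proof. exact: norths_cons. Qed.

Lemma upper_cons l w i : upper (l :: w) i.+1 = l.2 + upper w i.
Proof. exact: norths_cons. Qed.

Lemma lower_catl u v i : i <= size u -> lower (u ++ v) i = lower u i.
Proof. by move=> le_i; rewrite /lower /unzip1 map_cat norths_catl ?size_map. Qed.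

Lemma upper_catl u v i : i <= size u -> upper (u ++ v) i = upper u i.
Proof. by move=> le_i; rewrite /upper /unzip2 map_cat norths_catl ?size_map. Qed.

Lemma lower_catr u v i :
  lower (u ++ v) (size u + i) = lower u (size u) + lower v i.
Proof. by rewrite /lower /unzip1 map_cat -[size u](size_map fst) norths_catr. Qed.

Lemma upper_catr u v i :
  upper (u ++ v) (size u + i) = upper u (size u) + upper v i.
Proof. by rewrite /upper /unzip2 map_cat -[size u](size_map snd) norths_catr. Qed.

(** * Shrinking a word *)

(** [w] arises from [w'] by removing letters, and [f i] counts the letters kept
    among the first [i].  Where the gap between the two paths is concerned,
    removal must be invisible: the gap in [w'] is never below the gap in [w],
    and among the positions of [w'] that are merged into one position of [w],
    some position has the same gap.  This is what makes it possible to contract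
    the removed steps that are North on the lower path and to delete the others
    (see [shrinking_minor]). *)
Record shrinking (f : nat -> nat) (w w' : word) : Prop := Shrinking {
  shr0 : f 0 = 0;
  shr_size : f (size w') = size w;
  shr_step : forall i, i < size w' ->
    f i.+1 = f i \/ f i.+1 = (f i).+1 /\ letter w' i = letter w (f i);
  shr_gap : forall i, i <= size w' ->
    upper w (f i) + lower w' i <= upper w' i + lower w (f i);
  shr_tight : forall c, c <= size w -> exists i, [/\ i <= size w', f i = c &
    upper w c + lower w' i = upper w' i + lower w c];
  shr_total : upper w (size w) + lower w' (size w') =
    upper w' (size w') + lower w (size w)
}.

Definition shrinks (w w' : word) : Prop := exists f, shrinking f w w'.

Lemma shr_mono f w w' i j : shrinking f w w' -> i <= j -> j <= size w' ->
  f i <= f j.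
Proof.
move=> sf; elim: j => [|j IHj]; first by rewrite leqn0 => /eqP->.
rewrite leq_eqVlt => /predU1P[-> //|le_ij] lt_j.
have := IHj le_ij (ltnW lt_j); have := shr_step sf lt_j; lia.
Qed.

Lemma shr_le f w w' i : shrinking f w w' -> i <= size w' -> f i <= size w.
Proof. by move=> sf le_i; rewrite -(shr_size sf) (shr_mono sf). Qed.

Lemma shrinks_refl w : shrinks w w.
Proof. by exists id; split=> // [i _ | c le_c]; [right | exists c]. Qed.

Lemma shrinks_trans w' w w'' : shrinks w w' -> shrinks w' w'' -> shrinks w w''.
Proof.
move=> [f sf] [g sg]; exists (f \o g); split=> /= [||i lt_i|i le_i|c le_c|].
- by rewrite (shr0 sg) (shr0 sf).
- by rewrite (shr_size sg) (shr_size sf).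
- have [->|[Eg ->]] := shr_step sg lt_i; first by left.
  have lt_g : g i < size w' by rewrite -Eg (shr_le sg).
  rewrite Eg.
  have [->|[-> ->]] := shr_step sf lt_g; [by left | by right].
- have := shr_gap sg le_i; have := shr_gap sf (shr_le sg le_i); lia.
- have [i [le_i fi ei]] := shr_tight sf le_c.
  have [j [le_j gj ej]] := shr_tight sg le_i.
  by exists j; split=> //; [rewrite gj | lia].
- have := shr_total sf; have := shr_total sg; lia.
Qed.

Lemma shrinks_cat u u' v v' : shrinks u u' -> shrinks v v' ->
  shrinks (u ++ v) (u' ++ v').
Proof.
move=> [f sf] [g sg].
pose h i := if i <= size u' then f i else size u + g (i - size u').
have hl i : i <= size u' -> h i = f i by rewrite /h => ->.
have hr i : h (size u' + i) = size u + g i.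
  rewrite /h addKn; case: ifP => // le_i; have -> : i = 0 by lia.
  by rewrite addn0 (shr_size sf) (shr0 sg) addn0.
have splitP i : i <= size (u' ++ v') ->
    i <= size u' \/ exists2 j, i = size u' + j & j <= size v'.
  rewrite size_cat; have [le_i|lt_i] := leqP i (size u'); first by left.
  by right; exists (i - size u'); lia.
exists h; split=> [||i lt_i|i le_i|c|].
- by rewrite hl ?(shr0 sf).
- by rewrite !size_cat hr (shr_size sg).
- have [lt_iu|le_ui] := ltnP i (size u').
    rewrite !hl // 1?ltnW //.
    have [->|[E El]] := shr_step sf lt_iu; [by left | right; split=> //].
    have lt_f : f i < size u by rewrite -E (shr_le sf).
    by rewrite /letter !nth_cat lt_iu lt_f.
  have -> : i = size u' + (i - size u') by lia.
  have lt_j : i - size u' < size v' by move: lt_i; rewrite size_cat; lia.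
  set j := i - size u' in lt_j *; rewrite -addnS !hr.
  have [->|[-> El]] := shr_step sg lt_j; [by left | right; split; first by lia].
  by rewrite /letter !nth_cat !ltnNge !leq_addr !addKn.
- have [le_iu|[j -> le_j]] := splitP i le_i.
    have le_f := shr_le sf le_iu.
    by rewrite hl // !lower_catl ?upper_catl // (shr_gap sf).
  rewrite hr !lower_catr !upper_catr.
  have := shr_gap sg le_j; have := shr_total sf; lia.
- rewrite size_cat => le_c; have [le_cu|lt_uc] := leqP c (size u).
    have [i [le_i fi ei]] := shr_tight sf le_cu.
    exists i; split; rewrite ?size_cat; first exact: leq_trans (leq_addr _ _).
      by rewrite hl.
    by rewrite !lower_catl ?upper_catl.
  have [d Ec] : exists d, c = size u + d by exists (c - size u); lia.
  rewrite {c lt_uc}Ec leq_add2l in le_c *.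
  have [i [le_i gi ei]] := shr_tight sg le_c.
  exists (size u' + i); split; rewrite ?size_cat ?leq_add2l ?hr ?gi //.
  by rewrite !lower_catr !upper_catr; have := shr_total sf; lia.
- rewrite !size_cat !lower_catr !upper_catr.
  by have := shr_total sf; have := shr_total sg; lia.
Qed.

(** * Well-quasi-ordering of the words of bounded gap *)

Definition balanced (w : word) : Prop :=
  lower w (size w) = upper w (size w) /\
  forall i, i <= size w -> lower w i <= upper w i.

(** Bounding the gap only before a letter makes the empty word the only one
    in [dyck 0]. *)
Definition dyck (K : nat) (w : word) : Prop :=
  balanced w /\ forall i, i < size w -> upper w i < lower w i + K.

Lemma shrinks_nil w : balanced w -> shrinks [::] w.
Proof.
move=> [tot_w pos_w]; exists (fun=> 0); split=> //= [i _|i le_i|c|].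
- by left.
- by rewrite upper0 lower0 addn0 pos_w.
- by rewrite leqn0 => /eqP->; exists 0; rewrite !upper0 !lower0.
- by rewrite upper0 lower0 addn0.
Qed.

(** Every block is a letter of a finite alphabet together with a word, so that
    blocks are compared by a product order. The label [None] stands for a bump
    with the given interior; a flat step is [Some b] with the empty word. *)
Definition block (lx : option bool * word) : word :=
  if lx.1 is Some b then (b, b) :: lx.2
  else (East, North) :: lx.2 ++ [:: (North, East)].

Definition block_le (lx ly : option bool * word) : Prop :=
  lx.1 = ly.1 /\ shrinks lx.2 ly.2.

Lemma shrinks_block lx ly : block_le lx ly -> shrinks (block lx) (block ly).
Proof.
case: lx ly => [l x] [m y] [/= Elm xy]; rewrite -{m}Elm.
have cons a := shrinks_cat (shrinks_refl [:: a]).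
case: l => [b|]; rewrite /block /=; first exact: cons.
exact: cons (shrinks_cat xy (shrinks_refl _)).
Qed.

Lemma balanced_block lx : balanced lx.2 -> balanced (block lx).
Proof.
rewrite /block; case: lx => [[b|] x] [/= tot_x pos_x].
  split=> [|[|i]] //=; rewrite ?lower0 ?upper0 ?lower_cons ?upper_cons //=.
    by rewrite tot_x.
  by rewrite ltnS leq_add2l => /pos_x.
have tot1 : lower (x ++ [:: (North, East)]) (size x).+1 =
            (upper (x ++ [:: (North, East)]) (size x).+1).+1.
  rewrite !lowerS !upperS lower_catl ?upper_catl // /letter nth_cat ltnn subnn.
  by rewrite tot_x /=; lia.
split=> [|[|i]] /=; rewrite ?lower0 ?upper0 // size_cat addn1 lower_cons upper_cons.
  by rewrite tot1.
rewrite ltnS leq_eqVlt => /predU1P[->|]; first by rewrite tot1.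
rewrite ltnS => le_i; rewrite lower_catl ?upper_catl //=.
exact: leqW (pos_x i le_i).
Qed.

Lemma shrinks_blocks s t : all_in (fun lx => balanced lx.2) t ->
  list_emb block_le s t ->
  shrinks (flatten (map block s)) (flatten (map block t)).
Proof.
move=> dt st; elim: st dt => {s t} [|lx s t _ IHst|lx ly s t le_xy _ IHst] /=.
- by move=> _; apply: shrinks_refl.
- move=> [dx dt]; apply: (@shrinks_cat [::]); last exact: IHst.
  exact: shrinks_nil (balanced_block dx).
- by move=> [_ dt]; apply: shrinks_cat; [apply: shrinks_block | apply: IHst].
Qed.

(** A bump ends at the first return of the gap to zero. *)
Lemma block_decomposition K w : dyck K.+1 w ->
  exists2 s, all_in (fun lx => dyck K lx.2) s & w = flatten (map block s).
Proof.
have [n] := ubnP (size w); elim: n w => // n IHn [|[p q] w]; first by exists [::].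
rewrite /= ltnS => lt_n dw.
suff [lx [rest [dx Ew dr lt_r]]] : exists lx rest,
    [/\ dyck K lx.2, (p, q) :: w = block lx ++ rest, dyck K.+1 rest & size rest <= size w].
  have [|s ds Er] := IHn rest _ dr; first exact: leq_ltn_trans lt_r lt_n.
  by exists (lx :: s); rewrite //= Ew Er.
have [[tot pos] ltK] := dw.
have [Epq|] := eqVneq p q.
  rewrite -{q}Epq in dw tot pos ltK *; exists (Some p, [::]), w; split=> //.
  split; [split=> [|i le_i] | move=> i lt_i].
  - by have := tot; rewrite /= lower_cons upper_cons /=; lia.
  - by have := pos i.+1 le_i; rewrite lower_cons upper_cons /=; lia.
  - by have := ltK i.+1 lt_i; rewrite lower_cons upper_cons /=; lia.
have := pos 1 isT; rewrite lower_cons upper_cons lower0 upper0 /=.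
case: p q => -[] // in dw tot pos ltK *; move=> _ _.
set w' := _ :: w in dw tot pos ltK *.
have ex_ret : exists k, (0 < k <= size w') && (lower w' k == upper w' k).
  by exists (size w'); rewrite tot eqxx leqnn.
case: (ex_minnP ex_ret) => k /andP[/andP[k_gt0 le_k] /eqP gap0] min_k.
have pos_k i : 0 < i < k -> lower w' i < upper w' i.
  move=> /andP[i_gt0 lt_i]; rewrite ltn_neqAle pos ?andbT; last by lia.
  apply/eqP=> eq_i; have := min_k i; rewrite eq_i eqxx andbT; lia.
have gap1 : upper w' 1 = (lower w' 1).+1.
  by rewrite lower_cons upper_cons lower0 upper0.
have [j Ek] : exists j, k = j.+2.
  case: k k_gt0 gap0 {le_k min_k pos_k} => [//|[|j]] _; last by exists j.
  by rewrite gap1; lia.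
rewrite {k}Ek in k_gt0 le_k gap0 min_k pos_k.
have lt_j : j < size w by move: le_k; rewrite /= ltnS.
pose x := take j w; pose rest := drop j.+1 w.
have sx : size x = j by rewrite size_take lt_j.
have lower_x i : i <= j -> lower x i = lower w' i.+1.
  move=> le_i; rewrite lower_cons add0n -(cat_take_drop j w) lower_catl ?sx //.
have upper_x i : i <= j -> upper w' i.+1 = (upper x i).+1.
  move=> le_i; rewrite upper_cons add1n -(cat_take_drop j w) upper_catl ?sx //.
have [Ed gap_x] : letter w j = (North, East) /\ lower x j = upper x j.
  have := pos_k j.+1; rewrite ltnSn upper_x // -lower_x // => /(_ isT).
  have := gap0; rewrite lowerS upperS upper_x // -lower_x //.
  have -> : letter w' j.+1 = letter w j by [].
  by case: (letter w j) => -[] [] /=; rewrite /North /East; split=> //; lia.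
have Ew : w = x ++ (North, East) :: rest.
  by rewrite -Ed /letter -drop_nth // cat_take_drop.
have Ew' : w' = block (None, x) ++ rest by rewrite /w' Ew /block /= -catA.
have sb : size (block (None, x)) = j.+2 by rewrite /= size_cat sx addn1.
have lower_r i : lower w' (j.+2 + i) = lower w' j.+2 + lower rest i.
  by rewrite Ew' -sb lower_catr lower_catl.
have upper_r i : upper w' (j.+2 + i) = upper w' j.+2 + upper rest i.
  by rewrite Ew' -sb upper_catr upper_catl.
have sw' : size w' = j.+2 + size rest by rewrite Ew' size_cat sb.
exists (None, x), rest; split=> //=.
- split; [split=> [|i] | move=> i]; rewrite /= sx // => lt_i.
    have := pos_k i.+1; rewrite upper_x // -lower_x //; lia.
  have le_i := ltnW lt_i; have := ltK i.+1; rewrite upper_x // -lower_x //= ltnS; lia.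
- split; [split=> [|i le_i] | move=> i lt_i].
  + by have := tot; rewrite sw' lower_r upper_r; lia.
  + have := pos (j.+2 + i); rewrite lower_r upper_r; lia.
  + have := ltK (j.+2 + i); rewrite lower_r upper_r; lia.
- by have := sw'; rewrite /=; lia.
Qed.

Lemma wqo_finite (T : finType) : wqo_on (fun=> True) (@eq T).
Proof.
move=> a _; have : ~~ uniq (mkseq a #|T|.+1).
  apply/negP=> Ua; have := max_card (mem (mkseq a #|T|.+1)).
  by rewrite (card_uniqP Ua) size_mkseq ltnn.
case/(uniqPn (a 0)) => i [j []]; rewrite size_mkseq => lt_ij lt_j.
by rewrite !nth_mkseq //; [exists i, j | apply: ltn_trans lt_j].
Qed.

(** A word in [dyck K.+1] is a list of blocks, each of them a letter of a finite
    alphabet together with a word in [dyck K]: Higman's lemma applies [K] times. *)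
Lemma wqo_dyck K : wqo_on (dyck K) shrinks.
Proof.
elim: K => [|K IHK] w dw.
  have w0 i : w i = [::].
    by have [_ K0] := dw i; apply/nilP; rewrite /nilp; have := K0 0;
       rewrite lower0 upper0; case: (size _) => // n /(_ isT).
  by exists 0, 1; rewrite !w0; split=> //; apply: shrinks_refl.
have wqo_block : wqo_on (fun lx => dyck K lx.2) block_le.
  move=> lx dx.
  have eq_tr (y x z : option bool) : x = y -> y = z -> x = z by move=> ->.
  have [phi phi_mono phi_eq] := @ascending_subsequence _ _ _ (fun i => (lx i).1)
    eq_tr (@wqo_finite (option bool)) (fun=> I).
  have [i [j [lt_ij sij]]] := IHK (fun i => (lx (phi i)).2) (fun i => dx (phi i)).
  by exists (phi i), (phi j); split; [apply: phi_mono | split=> //; apply: phi_eq].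
have block_trans y x z : block_le x y -> block_le y z -> block_le x z.
  by move=> [exy xy] [eyz yz]; split; [rewrite exy | apply: shrinks_trans yz].
have /choice[s sP] : forall i, exists s,
    all_in (fun lx => dyck K lx.2) s /\ w i = flatten (map block s).
  by move=> i; have [s ds Ew] := block_decomposition (dw i); exists s.
have [i [j [lt_ij emb]]] := higman block_trans wqo_block (fun i => proj1 (sP i)).
exists i, j; split=> //; rewrite (proj2 (sP i)) (proj2 (sP j)).
apply: shrinks_blocks emb.
by elim: (s j) (proj1 (sP j)) => //= lx t IHt [[bx _] /IHt].
Qed.

(** * Independence in a lattice path matroid *)

Definition below n (X : {set 'I_n}) (i : nat) : nat := #|[set x in X | x < i]|.

Lemma below0 n (X : {set 'I_n}) : below X 0 = 0.
Proof. by apply/eqP; rewrite cards_eq0; apply/eqP/setP=> x; rewrite !inE andbF. Qed.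

Lemma belowS n (X : {set 'I_n}) (x : 'I_n) : below X x.+1 = below X x + (x \in X).
Proof.
rewrite /below (cardsD1 x) inE ltnSn andbT addnC; congr (_ + _).
by apply: eq_card => y; rewrite !inE ltnS (leq_eqVlt y) -val_eqE /=; case: (y \in X); case: ltngtP.
Qed.

Lemma below_setU n (X Y : {set 'I_n}) i : [disjoint X & Y] ->
  below (X :|: Y) i = below X i + below Y i.
Proof.
move=> dXY; rewrite /below -cardsUI [X in _ + X]eq_card0 ?addn0.
  by apply: eq_card => x; rewrite !inE andb_orl.
move=> x; rewrite !inE; apply/negP=> /andP[/andP[xX _] /andP[xY _]].
by have := disjointFr dXY xX; rewrite xY.
Qed.

Lemma below_imset (T : finType) n (h : T -> 'I_n) (X : {set T}) i :
  injective h -> below (h @: X) i = #|[set z in X | h z < i]|.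
Proof.
move=> inj_h; rewrite /below -(card_imset _ inj_h).
apply: eq_card => x; rewrite inE; apply/andP/imsetP => [[/imsetP[z zX ->] lt_z]|[z]].
  by exists z; rewrite // inE zX.
by rewrite inE => /andP[zX lt_z] ->; rewrite imset_f.
Qed.

Lemma below_all n (X : {set 'I_n}) : below X n = #|X|.
Proof. by apply: eq_card => x; rewrite inE ltn_ord andbT. Qed.

Lemma below_interval n (X : {set 'I_n}) i j : i <= j ->
  below X j = below X i + #|[set x in X | i <= x < j]|.
Proof.
move=> le_ij; rewrite /below -cardsUI [X in _ = _ + X]eq_card0 ?addn0.
  apply: eq_card => x; rewrite !inE.
  by case: (x \in X) => //=; lia.
by move=> x; rewrite !inE; case: (x \in X) => //=; lia.
Qed.

Lemma size_north_positions s : size (north_positions s) = count_mem North s.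
Proof.
rewrite /north_positions size_filter -{3}(mkseq_nth East s) /mkseq count_map.
by apply: eq_count.
Qed.

Lemma north_positions_cons b s :
  north_positions (b :: s) = (if b then [:: 0] else [::]) ++ map succn (north_positions s).
Proof.
rewrite /north_positions /= -[1]addn0 iotaDl filter_map.
rewrite (eq_map (_ : addn 1 =1 succn)) //.
by case: b.
Qed.

Lemma nth_north_positions_lt s t y : t < count_mem North s ->
  (nth 0 (north_positions s) t < y) = (t < norths s y).
Proof.
elim: s t y => [|b s IHs] t y //=; rewrite north_positions_cons.
case: y => [|y]; first by rewrite norths0 !ltn0.
rewrite norths_cons; case: b; last first.
  rewrite /= add0n => lt_t.
  by rewrite (nth_map 0) ?size_north_positions // ltnS IHs.
case: t => [|t] //=; rewrite add1n !ltnS => lt_t.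
by rewrite (nth_map 0) ?size_north_positions // IHs.
Qed.

Lemma norths_max s i : norths s i <= count_mem North s.
Proof. by rewrite /norths -{2}(cat_take_drop i s) count_cat leq_addr. Qed.

Section LatticePathMatroid.
Variables (m r : nat) (P Q : (m + r).-tuple bool).
Hypotheses (LP : is_lattice_path P) (LQ : is_lattice_path Q) (PQ : never_above P Q).

Lemma mem_lpm_interval (t : 'I_r) (x : 'I_(m + r)) :
  (x \in lpm_interval P Q t) = (norths P x <= t < norths Q x.+1).
Proof.
have lt_P : t < count_mem North P by rewrite LP.
have lt_Q : t < count_mem North Q by rewrite LQ.
rewrite inE -[nth _ _ _ <= x]ltnS [x <= _]leqNgt !nth_north_positions_lt //.
by rewrite -leqNgt andbC.
Qed.

(** Among the indices [t], exactly those with [norths P i <= t < norths Q j] have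
    an interval that meets the positions from [i] to [j - 1], so the condition is
    Hall's condition for such segments. Conversely, one can match the elements
    of [X] from left to right, each with the least index that is still possible:
    for [x] this is the maximum, over the [y] in [X] up to [x], of the first
    index available to [y] plus the number of elements of [X] from [y] on that come before [x]. *)
Lemma lpm_indepP (X : {set 'I_(m + r)}) : @indep (lpm P Q) X <->
  (forall i j, i <= j -> j <= m + r -> below X j + norths P i <= norths Q j + below X i).
Proof.
split=> [/existsP[f /andP[/dinjectiveP inj_f /forall_inP fX]] i j le_ij le_j|HX].
  rewrite (below_interval X le_ij).
  set Y := [set x in X | _].
  pose g x := oapp val 0 (f x).
  have inj_g : {in Y &, injective g}.
    move=> x y; rewrite !inE => /andP[xX _] /andP[yX _]; rewrite /g.
    have /existsP[t /andP[/eqP Ex _]] := fX x xX.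
    have /existsP[s /andP[/eqP Ey _]] := fX y yX.
    by rewrite Ex Ey /= => /val_inj ets; apply: inj_f; rewrite // Ex Ey ets.
  suff: size (map g (enum Y)) <= size (index_iota (norths P i) (norths Q j)).
    have le_PQ : norths P j <= norths Q j by apply: PQ.
    have /andP[le_P _] := norths_steps P le_ij.
    by rewrite size_map size_iota -cardE; lia.
  apply: uniq_leq_size => [|_ /mapP[x + ->]].
    rewrite map_inj_in_uniq ?enum_uniq // => x y; rewrite !mem_enum; exact: inj_g.
  rewrite mem_enum inE => /andP[xX /andP[le_ix lt_xj]].
  have /existsP[t /andP[/eqP Ex]] := fX x xX.
  rewrite mem_lpm_interval mem_index_iota /g Ex /= => /andP[le_t lt_t].
  have /andP[le_P _] := norths_steps P le_ix.
  have /andP[le_Q _] := norths_steps Q lt_xj.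
  by rewrite (leq_trans le_P) // (leq_trans lt_t).
pose slot (x : 'I_(m + r)) : nat :=
  \max_(y : 'I_(m + r) | (y \in X) && (y <= x)) (norths P y + below X x - below X y).
have slot_ge (x y : 'I_(m + r)) : y \in X -> y <= x ->
    norths P y + below X x - below X y <= slot x.
  move=> yX le_yx; rewrite /slot.
  by apply: (@leq_bigmax_cond _ _ (fun y : 'I__ => norths P y + _ - _)); rewrite yX.
have slot_max x : x \in X -> exists y : 'I_(m + r),
    [/\ y \in X, y <= x & slot x = norths P y + below X x - below X y].
  move=> xX; have Px : (x \in X) && (x <= x) by rewrite xX leqnn.
  rewrite /slot (bigmax_eq_arg x Px).
  by case: arg_maxnP => // y /andP[yX le_yx] _; exists y.
have below_le (x y : 'I_(m + r)) : x <= y -> below X x <= below X y.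
  by move=> le_xy; rewrite (below_interval X le_xy) leq_addr.
have slot_interval x : x \in X -> norths P x <= slot x < norths Q x.+1.
  move=> xX; apply/andP; split; first by have := slot_ge x x xX (leqnn _); lia.
  have [y [yX le_yx ->]] := slot_max x xX.
  have := HX y x.+1 (leqW le_yx) (ltn_ord x).
  have := below_le y x le_yx; rewrite belowS xX; lia.
have slot_mono (x y : 'I_(m + r)) : x \in X -> y \in X -> x < y -> slot x < slot y.
  move=> xX yX lt_xy; have [z [zX le_zx ->]] := slot_max x xX.
  have := slot_ge y z zX (leq_trans le_zx (ltnW lt_xy)).
  have := below_le z x le_zx; have := belowS X x.
  rewrite (below_interval X lt_xy) xX; lia.
have slot_lt x : x \in X -> slot x < r.
  move=> /slot_interval/andP[_ /leq_trans]; apply.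
  by apply: leq_trans (norths_max _ _) _; rewrite LQ.
apply/existsP; exists [ffun x => insub (slot x)]; apply/andP; split.
  apply/dinjectiveP=> x y xX yX; rewrite !ffunE.
  rewrite (insubT (fun i => i < r) (slot_lt x xX)).
  rewrite (insubT (fun i => i < r) (slot_lt y yX)) => -[eq_slot].
  apply/val_inj => /=; have [||//] := ltngtP x y => lt.
    by have := slot_mono x y xX yX lt; rewrite eq_slot ltnn.
  by have := slot_mono y x yX xX lt; rewrite eq_slot ltnn.
apply/forall_inP=> x xX; apply/existsP; exists (Ordinal (slot_lt x xX)).
rewrite ffunE (insubT (fun i => i < r) (slot_lt x xX)) eqxx /=.
by rewrite mem_lpm_interval slot_interval.
Qed.

End LatticePathMatroid.

(** * Shrinking a word gives a minor *)

Lemma isomorphic_sym M N : isomorphic M N -> isomorphic N M.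
Proof.
case=> f [g fK gK] fX; exists g => [|X]; first by exists f.
by rewrite -fX -imset_comp (eq_imset _ gK) imset_id.
Qed.

Lemma isomorphic_trans N M K : isomorphic M N -> isomorphic N K -> isomorphic M K.
Proof.
case=> f bij_f fX [g bij_g gX]; exists (g \o f) => [|X]; first exact: bij_comp.
by rewrite imset_comp gX fX.
Qed.

Section MinorIso.
Variables (M M' : matroid) (f : M -> M').
Hypotheses (bij_f : bijective f) (fX : forall X : {set M}, indep (f @: X) = indep X).

Lemma rank_iso (X : {set M}) : rank (f @: X) = rank X.
Proof.
have inj_f := bij_inj bij_f; have [g fK gK] := bij_f.
have gX (Y : {set M'}) : f @: (g @: Y) = Y.
  by rewrite -imset_comp (eq_imset _ gK) imset_id.
have fgX (Y : {set M}) : g @: (f @: Y) = Y.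
  by rewrite -imset_comp (eq_imset _ fK) imset_id.
apply/eqP; rewrite eqn_leq; apply/andP; split.
  have [I [iI sI <-]] := rank_witness (f @: X).
  rewrite -(card_imset _ (can_inj gK)) indep_rank -?fX ?gX //.
  by rewrite -(fgX X) imsetS.
have [I [iI sI <-]] := rank_witness X.
by rewrite -(card_imset _ inj_f) indep_rank ?fX ?imsetS.
Qed.

Variables C D : {set M'}.
Local Notation pre X := (f @^-1: X).

Let pre_notin (z : minor (pre C) (pre D)) : f (val z) \notin C :|: D.
Proof. by have := valP z; rewrite !inE. Qed.

Lemma minor_iso : isomorphic (minor (pre C) (pre D)) (minor C D).
Proof.
have inj_f := bij_inj bij_f; have [g fK gK] := bij_f.
have onto (X : {set M'}) : f @: (pre X) = X.
  apply/setP=> x; apply/imsetP/idP => [[y]|xX]; first by rewrite inE => yX ->.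
  by exists (g x); rewrite ?inE gK.
have rank_pre (X : {set M'}) : rank (pre X) = rank X by rewrite -rank_iso onto.
have post_notin (z : minor C D) : g (val z) \notin pre C :|: pre D.
  by have := valP z; rewrite !inE gK.
pose h (z : minor (pre C) (pre D)) : minor C D := Sub (f (val z)) (pre_notin z).
pose h' (z : minor C D) : minor (pre C) (pre D) := Sub (g (val z)) (post_notin z).
have inj_h : injective h by move=> y z /(congr1 val) /= /inj_f /val_inj.
exists h => [|X].
  exists h' => z; apply: val_inj => /=.
    exact: fK.
  exact: gK.
rewrite /indep /= /minor_indep card_imset // -imset_comp.
have -> : (val \o h) @: X :|: C = f @: (val @: X :|: pre C).
  by rewrite imsetU onto -imset_comp.
by rewrite rank_iso rank_pre.
Qed.

End MinorIso.

Lemma isomorphic_to_minor_iso N N' M M' : isomorphic N N' -> isomorphic M M' ->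
  isomorphic_to_minor N' M' -> isomorphic_to_minor N M.
Proof.
move=> isoN [f bij_f fX] [C [D [dCD isoN']]].
exists (f @^-1: C), (f @^-1: D); split.
  rewrite disjoints_subset; apply/subsetP=> x; rewrite !inE => fC.
  by rewrite (disjointFr dCD fC).
apply: isomorphic_trans isoN _; apply: isomorphic_trans isoN' _.
exact: isomorphic_sym (minor_iso bij_f fX C D).
Qed.

Lemma unit_steps_onto (f : nat -> nat) n c : f 0 = 0 ->
  (forall i, i < n -> f i.+1 = f i \/ f i.+1 = (f i).+1) -> c < f n ->
  exists i, [/\ i < n, f i = c & f i.+1 = c.+1].
Proof.
move=> f0; elim: n => [|n IHn] fS; first by rewrite f0.
have [lt_cn|le_nc] := ltnP c (f n) => lt_c.
  by have [|i [lt_i fi fi1]] := IHn _ lt_cn;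
    [move=> i lt_i; apply: fS; apply: ltnW | exists i; rewrite ltnW].
by exists n; have := fS n (ltnSn n); split=> //; lia.
Qed.

Section ShrinksMinor.
Variables (m r : nat) (P Q : (m + r).-tuple bool).
Variables (m' r' : nat) (P' Q' : (m' + r').-tuple bool).
Hypotheses (LP : is_lattice_path P) (LQ : is_lattice_path Q) (PQ : never_above P Q).
Hypotheses (LP' : is_lattice_path P') (LQ' : is_lattice_path Q').
Hypothesis (PQ' : never_above P' Q').
Variable f : nat -> nat.
Hypothesis sf : shrinking f (zip P Q) (zip P' Q').

Local Notation n := (m + r).
Local Notation n' := (m' + r').

Let size_zip : size (zip P Q) = n.
Proof. by rewrite size_zip !size_tuple minnn. Qed.

Let size_zip' : size (zip P' Q') = n'.
Proof. by rewrite seq.size_zip !size_tuple minnn. Qed.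

Let lowerE i : lower (zip P Q) i = norths P i.
Proof. by rewrite /lower unzip1_zip // !size_tuple. Qed.
Let upperE i : upper (zip P Q) i = norths Q i.
Proof. by rewrite /upper unzip2_zip // !size_tuple. Qed.
Let lowerE' i : lower (zip P' Q') i = norths P' i.
Proof. by rewrite /lower unzip1_zip // !size_tuple. Qed.
Let upperE' i : upper (zip P' Q') i = norths Q' i.
Proof. by rewrite /upper unzip2_zip // !size_tuple. Qed.

Let contracted : {set lpm P' Q'} :=
  [set x : 'I_n' | (f x.+1 == f x) && (letter (zip P' Q') x).1].
Let deleted : {set lpm P' Q'} :=
  [set x : 'I_n' | (f x.+1 == f x) && ~~ (letter (zip P' Q') x).1].

Let step i : i < n' -> f i.+1 = f i \/
  f i.+1 = (f i).+1 /\ letter (zip P' Q') i = letter (zip P Q) (f i).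
Proof. by move=> lt_i; apply: (shr_step sf); rewrite size_zip'. Qed.

Let mono i j : i <= j -> j <= n' -> f i <= f j.
Proof. by move=> le_ij le_j; apply: (shr_mono sf) => //; rewrite size_zip'. Qed.

Let f_size : f n' = n.
Proof. by have := shr_size sf; rewrite size_zip size_zip'. Qed.

Lemma kept_step (z : minor contracted deleted) : f (val z).+1 = (f (val z)).+1.
Proof.
have := valP z; rewrite !inE; set b := (letter _ _).1.
case: eqP => [_|]; first by case: b.
by have [|[-> _]] := step (ltn_ord (val z)).
Qed.

Lemma kept_lt (z : minor contracted deleted) : f (val z) < n.
Proof. by rewrite -kept_step -f_size mono. Qed.

Definition kept (z : minor contracted deleted) : lpm P Q := Ordinal (kept_lt z).

Lemma kept_ltE (z : minor contracted deleted) i : i <= n' ->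
  (kept z < f i) = (val z < i).
Proof.
move=> le_i; case: (ltnP (val z) i) => [lt_z|le_z] /=.
  by rewrite -kept_step mono.
by rewrite ltnNge mono // ltnW.
Qed.

Lemma kept_inj : injective kept.
Proof.
move=> y z eq_yz; apply/val_inj/val_inj => /=.
have := kept_ltE y (ltnW (ltn_ord (val z))); have := kept_ltE z (ltnW (ltn_ord (val y))).
by rewrite eq_yz -[in _ < f (val y)]eq_yz /= !ltnn; case: ltngtP.
Qed.

Lemma kept_bij : bijective kept.
Proof.
apply: (inj_card_bij kept_inj); rewrite -(card_codom kept_inj).
apply/subset_leq_card/subsetP=> c _.
have [||i [lt_i fi fi1]] := @unit_steps_onto f n' c (shr0 sf).
- by move=> i /step[->|[-> _]]; [left | right].
- by rewrite f_size.
have Nz : Ordinal lt_i \notin contracted :|: deleted.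
  by rewrite !inE /= fi fi1 gtn_eqF.
by apply/codomP; exists (Sub (Ordinal lt_i) Nz); apply/val_inj.
Qed.

Lemma lower_contracted i : i <= n' ->
  norths P' i = norths P (f i) + below contracted i.
Proof.
elim: i => [|i IHi] lt_i; first by rewrite (shr0 sf) !norths0 below0.
have := IHi (ltnW lt_i); rewrite -!lowerE -!lowerE' lowerS => ->.
rewrite (belowS contracted (Ordinal lt_i)) inE /=.
have [->|[-> ->]] := step lt_i; first by rewrite eqxx /= addnA.
by rewrite lowerS gtn_eqF //= addn0 addnAC.
Qed.

Lemma below_kept (X : {set minor contracted deleted}) i : i <= n' ->
  below (val @: X : {set 'I_n'}) i = below (kept @: X) (f i).
Proof.
move=> le_i; rewrite !below_imset; [|exact: kept_inj|exact: val_inj].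
by apply: eq_card => z; rewrite !inE kept_ltE.
Qed.

(** Contracted elements raise the lower path and the number of elements below a
    position by the same amount, so they cancel in the condition of [lpm_indepP];
    what remains of the condition at [i <= j] is the one at [f i <= f j], with the
    upper height at [f j] replaced by one that is no smaller, and equal to it when
    [j] is a tight position. *)
Lemma kept_indep (X : {set minor contracted deleted}) :
  indep (val @: X :|: contracted) = indep (kept @: X).
Proof.
have dXC : [disjoint val @: X & contracted].
  rewrite disjoints_subset; apply/subsetP=> _ /imsetP[z _ ->]; rewrite inE.
  by have := valP z; rewrite inE negb_or => /andP[].
have belowU i := below_setU i dXC.
apply/idP/idP => /lpm_indepP HX; apply/lpm_indepP => //.
  move=> c d; rewrite leq_eqVlt => /predU1P[-> _|lt_cd le_d].
    by rewrite addnC leq_add2r; apply: PQ.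
  have [|i [le_i fi ei]] := @shr_tight _ _ _ sf c; first by rewrite size_zip; lia.
  have [|j [le_j fj ej]] := @shr_tight _ _ _ sf d; first by rewrite size_zip.
  rewrite size_zip' in le_i le_j.
  have le_ij : i <= j.
    by rewrite leqNgt; apply/negP=> lt_ji; have := mono (ltnW lt_ji) le_i; lia.
  have := HX LP' LQ' PQ' i j le_ij le_j; rewrite !belowU !below_kept // fi fj.
  have := lower_contracted le_i; have := lower_contracted le_j; rewrite fi fj.
  by move: ej; rewrite lowerE upperE lowerE' upperE'; lia.
move=> i j le_ij le_j; have le_i := leq_trans le_ij le_j.
rewrite !belowU !below_kept //.
have := lower_contracted le_i; have := lower_contracted le_j.
have le_fj : f j <= n by rewrite -f_size mono.
have := HX LP LQ PQ (f i) (f j) (mono le_ij le_j) le_fj.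
have := @shr_gap _ _ _ sf j; rewrite size_zip' le_j lowerE upperE lowerE' upperE'.
by move=> /(_ isT); lia.
Qed.

Lemma shrinking_minor : isomorphic_to_minor (lpm P Q) (lpm P' Q').
Proof.
exists contracted, deleted; split.
  rewrite disjoints_subset; apply/subsetP=> x; rewrite !inE.
  by case/andP=> -> ->.
apply: isomorphic_sym; exists kept => [|X]; first exact: kept_bij.
have iC : indep contracted.
  by have := kept_indep set0; rewrite !imset0 set0U indep0.
have cC : #|contracted| = rank contracted.
  apply/eqP; rewrite eqn_leq indep_rank //=.
  by have [I [_ sI <-]] := rank_witness contracted; apply: subset_leq_card.
rewrite -kept_indep /indep /= /minor_indep -(card_imset (mem X) val_inj).
rewrite (rank_contractE iC (subxx _) cC) //.
rewrite disjoints_subset; apply/subsetP=> _ /imsetP[z _ ->]; rewrite inE.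
by have := valP z; rewrite inE negb_or => /andP[].
Qed.

End ShrinksMinor.

(** * A large gap gives a large uniform minor *)

(** The minor obtained by contracting [C] and restricting to [W] is uniform of
    rank [k] on [2k] elements, where [C] and any [k] elements of [W] form a
    basis. *)
Definition uniform_window (M : matroid) (k : nat) : Prop :=
  exists C W : {set M}, [/\ [disjoint C & W], #|W| = k.*2,
    forall A : {set M}, A \subset W -> #|A| = k -> indep (C :|: A)
    & rank [set: M] <= #|C| + k].

Lemma uniform_window_iso M N k :
  isomorphic M N -> uniform_window N k -> uniform_window M k.
Proof.
case=> f bij_f fX [C [W [dCW cW iCA rk]]].
have inj_f := bij_inj bij_f; have [g fK gK] := bij_f.
have onto (X : {set N}) : f @: (f @^-1: X) = X.
  apply/setP=> x; apply/imsetP/idP => [[y]|xX]; first by rewrite inE => yX ->.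
  by exists (g x); rewrite ?inE gK.
have card_pre (X : {set N}) : #|f @^-1: X| = #|X|.
  by rewrite -{2}(onto X) card_imset.
exists (f @^-1: C), (f @^-1: W); split.
- rewrite -setI_eq0 -preimsetI -(inj_eq (imset_inj inj_f)) onto imset0.
  by rewrite setI_eq0.
- by rewrite card_pre.
- move=> A sAW cA; rewrite -fX imsetU onto; apply: iCA; last by rewrite card_imset.
  by rewrite -(onto W) imsetS.
- rewrite card_pre; apply: leq_trans rk.
  have [I [iI _ <-]] := rank_witness [set: M].
  by rewrite -(card_imset _ inj_f) indep_rank ?fX ?subsetT.
Qed.

Lemma below_steps n (X : {set 'I_n}) i j : i <= j -> j <= n ->
  below X i <= below X j <= below X i + (j - i).
Proof.
move=> le_ij; elim: j le_ij => [|j IHj]; first by rewrite leqn0 => /eqP->; rewrite leqnn leq_addr.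
rewrite leq_eqVlt => /predU1P[->|]; first by rewrite leqnn leq_addr.
rewrite ltnS => le_ij lt_j; have := IHj le_ij (ltnW lt_j).
by rewrite (belowS X (Ordinal lt_j)) /=; case: (_ \in X); lia.
Qed.

Lemma below_setT n i : i <= n -> below [set: 'I_n] i = i.
Proof.
elim: i => [|i IHi] lt_i; first by rewrite below0.
by rewrite (belowS _ (Ordinal lt_i)) inE /= IHi ?addn1 // ltnW.
Qed.

Lemma card_segment n a b : a <= b -> b <= n ->
  #|[set x : 'I_n | a <= x < b]| = b - a.
Proof.
move=> le_ab le_b; have := below_interval [set: 'I_n] le_ab.
rewrite !below_setT // ?(leq_trans le_ab) // => {2}->; rewrite addKn.
by apply: eq_card => x; rewrite !inE.
Qed.

Section Window.
Variables (m r : nat) (P Q : (m + r).-tuple bool).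
Hypotheses (LP : is_lattice_path P) (LQ : is_lattice_path Q) (PQ : never_above P Q).
Variable i : nat.
Hypothesis le_i : i <= m + r.

Local Notation n := (m + r).
Local Notation k := (norths Q i - norths P i).

Let C1 : {set 'I_n} := [set x : 'I_n | nth false Q x && (norths Q x < norths P i)].
Let C2 : {set 'I_n} := [set x : 'I_n | nth false P x && (norths Q i <= norths P x)].
Let W : {set 'I_n} := [set x : 'I_n | i - k <= x < i + k].

Let le_PQ y : norths P y <= norths Q y. Proof. exact: PQ. Qed.

Let norths_end (R : n.-tuple bool) : is_lattice_path R -> norths R n = r.
Proof. by move=> LR; rewrite /norths take_oversize ?size_tuple. Qed.

Lemma below_C1 y : y <= n -> below C1 y = minn (norths Q y) (norths P i).
Proof.
elim: y => [|y IHy] lt_y; first by rewrite below0 norths0 min0n.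
rewrite (belowS C1 (Ordinal lt_y)) inE /= IHy ?northsS; last exact: ltnW.
by case: (nth _ _ _) => /=; lia.
Qed.

Lemma below_C2 y : y <= n -> below C2 y = norths P y - norths Q i.
Proof.
elim: y => [|y IHy] lt_y; first by rewrite below0 norths0.
rewrite (belowS C2 (Ordinal lt_y)) inE /= IHy ?northsS; last exact: ltnW.
by case: (nth _ _ _) => /=; lia.
Qed.

Lemma disjoint_C1_C2 : [disjoint C1 & C2].
Proof.
rewrite disjoints_subset; apply/subsetP=> x; rewrite !inE => /andP[_ lt_x].
by have := le_PQ i; have := le_PQ x; rewrite negb_and orbC -ltnNge; lia.
Qed.

Lemma disjoint_C_W : [disjoint C1 :|: C2 & W].
Proof.
rewrite disjoints_subset; apply/subsetP=> x; rewrite !inE => /orP[]/andP[_ lt_x].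
  have [le_xi|/ltnW le_ix] := leqP x i.
    by have := norths_steps Q le_xi; have := le_PQ i; lia.
  by have := norths_steps Q le_ix; have := le_PQ i; lia.
have [le_xi|/ltnW le_ix] := leqP x i.
  by have := norths_steps P le_xi; have := le_PQ i; lia.
by have := norths_steps P le_ix; have := le_PQ i; lia.
Qed.

Lemma window_bounds : k <= i /\ i + k <= n.
Proof.
have := norths_steps Q (leq0n i); have := norths_steps P le_i.
have := norths_steps Q le_i; rewrite !norths0 !norths_end //; lia.
Qed.

(** The contracted elements and [A] are the North steps of a path that follows
    [Q] up to height [norths P i], goes East up to the window, takes the steps
    [A] there, goes East up to [P], and then follows [P]. *)
Lemma window_indep (A : {set 'I_n}) : A \subset W -> #|A| = k ->
  @indep (lpm P Q) (C1 :|: C2 :|: A).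
Proof.
move=> sAW cA; apply/lpm_indepP => // y z le_yz le_z.
have [le_ki le_ik] := window_bounds.
have A_before : below A (i - k) = 0.
  apply/eqP; rewrite cards_eq0; apply/eqP/setP=> x; rewrite !inE.
  by apply/negP=> /andP[/(subsetP sAW)]; rewrite inE; lia.
have A_after : below A (i + k) = k.
  rewrite -{2}cA; apply: eq_card => x; rewrite inE.
  by apply: andb_idr => /(subsetP sAW); rewrite inE => /andP[].
have dCA : [disjoint C1 :|: C2 & A] by apply: disjointWr sAW disjoint_C_W.
have path_between x : x <= n ->
    norths P x <= below (C1 :|: C2 :|: A) x <= norths Q x.
  move=> le_x; rewrite !below_setU ?disjoint_C1_C2 // below_C1 // below_C2 //.
  have := le_PQ i; have := le_PQ x.
  have Abnd : below A x <= k.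
    by rewrite -cA; apply/subset_leq_card/subsetP=> a; rewrite inE => /andP[].
  have Alo : below A x <= x - (i - k).
    have [le_x'|/ltnW le_x'] := leqP x (i - k).
      by have := @below_steps _ A _ _ le_x' (leq_trans (leq_subr _ _) le_i); lia.
    by have := @below_steps _ A _ _ le_x' le_x; lia.
  have Ahi : k <= below A x + (i + k - x).
    have [le_x'|/ltnW le_x'] := leqP x (i + k).
      by have := @below_steps _ A _ _ le_x' le_ik; lia.
    by have := @below_steps _ A _ _ le_x' le_x; lia.
  have [le_xi|/ltnW le_ix] := leqP x i.
    by have := norths_steps Q le_xi; have := norths_steps P le_xi; lia.
  by have := norths_steps Q le_ix; have := norths_steps P le_ix; lia.
have := path_between y (leq_trans le_yz le_z); have := path_between z le_z; lia.
Qed.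

Lemma lpm_window : uniform_window (lpm P Q) k.
Proof.
have [le_ki le_ik] := window_bounds.
exists (C1 :|: C2), W; split; first exact: disjoint_C_W.
- by rewrite card_segment //; lia.
- exact: window_indep.
have [I [iI _ <-]] := rank_witness [set: lpm P Q].
have /(lpm_indepP LP LQ PQ)/(_ 0 n (leq0n _) (leqnn _)) := iI.
rewrite below_all below0 norths0 !addn0 norths_end // => le_I.
apply: leq_trans le_I _; rewrite -[X in _ <= X + _]below_all below_setU ?disjoint_C1_C2 //.
rewrite below_C1 // below_C2 // !norths_end //.
have := le_PQ i; have := norths_steps Q le_i; rewrite norths_end //.
by lia.
Qed.

End Window.

Lemma subset_between (T : finType) (A W : {set T}) k :
  A \subset W -> #|A| <= k -> k <= #|W| ->
  exists S : {set T}, [/\ A \subset S, S \subset W & #|S| = k].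
Proof.
move=> sAW le_A; elim: k le_A => [|k IHk].
  by rewrite leqn0 cards_eq0 => /eqP -> _; exists set0; rewrite !sub0set cards0.
rewrite leq_eqVlt => /predU1P[cA _|lt_A lt_W]; first by exists A.
have [S [sAS sSW cS]] := IHk lt_A (ltnW lt_W).
have /subsetPn[x xW xS] : ~~ (W \subset S).
  by apply: contraL lt_W => /subset_leq_card; rewrite cS -leqNgt.
exists (x |: S); split; first exact: subset_trans sAS (subsetUr _ _).
  by rewrite subUset sub1set xW.
by rewrite cardsU1 xS cS.
Qed.

(** On the side [Y], [C :&: Y] and as many elements of [W :&: Y] as the rank
    [k] allows are independent. The two sides together thus exceed the rank by
    at least the size of the smaller part of [W]. *)
Lemma window_lambda (M : matroid) k (C W X : {set M}) t :
  [disjoint C & W] -> #|W| = k.*2 ->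
  (forall A : {set M}, A \subset W -> #|A| = k -> indep (C :|: A)) ->
  rank [set: M] <= #|C| + k ->
  t <= k -> t <= #|W :&: X| -> t <= #|W :\: X| -> t < lambda X.
Proof.
move=> dCW cW iCA rk le_tk le_tX le_tY.
have rank_side (Y : {set M}) : #|C :&: Y| + minn k #|W :&: Y| <= rank Y.
  have [|||A [_ sA cA]] := @subset_between _ set0 (W :&: Y) (minn k #|W :&: Y|).
  - exact: sub0set.
  - by rewrite cards0.
  - exact: geq_minr.
  have [sAW sAY] : A \subset W /\ A \subset Y by apply/andP; rewrite -subsetI.
  have [|||S [sAS sSW cS]] := @subset_between _ A W k.
  - exact: sAW.
  - by rewrite cA geq_minl.
  - by rewrite cW -addnn leq_addr.
  have dCA : [disjoint C :&: Y & A].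
    exact: disjointW (subsetIl _ _) sAW dCW.
  rewrite -cA; have -> : #|C :&: Y| + #|A| = #|(C :&: Y) :|: A|.
    by rewrite cardsU (disjoint_setI0 dCA) cards0 subn0.
  apply: indep_rank; last by rewrite subUset subsetIr.
  by apply: indepS (iCA S sSW cS); apply: setUSS => //; apply: subsetIl.
have := rank_side X; have := rank_side (~: X); rewrite -!setDE /lambda.
have := cardsID X C; have := cardsID X W; rewrite cW -addnn.
by move: rk le_tk le_tX le_tY; lia.
Qed.

(** * Branch-decompositions have balanced edges *)

Section BalancedEdge.
Variables (M : matroid) (B : branch_decomposition M).

Local Notation V := (bd_vertex B).
Local Notation e := (@bd_edge M B).

Let e_sym : symmetric e. Proof. by case: (bd_tree B). Qed.
Let e_irr : irreflexive e. Proof. by case: (bd_tree B). Qed.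

Lemma del_edgeE u v x y : @del_edge M B u v x y =
  [&& e x y, ~~ ((x == u) && (y == v)) & ~~ ((x == v) && (y == u))].
Proof. by rewrite /del_edge /= !xpair_eqE. Qed.

Lemma del_edgeC u v : @del_edge M B u v =2 @del_edge M B v u.
Proof. by move=> x y; rewrite !del_edgeE; congr (_ && _); apply: andbC. Qed.

Lemma del_edge_sides u v z :
  connect (@del_edge M B u v) u z || connect (@del_edge M B u v) v z.
Proof.
have [_ _ _ conn _] := bd_tree B.
have /connectP[p + ->] := conn u z.
elim/last_ind: p => [|p y IHp] /=; first by rewrite connect0.
rewrite rcons_path last_rcons => /andP[/IHp + e_y].
set x := last u p in e_y *.
have [/andP[/eqP -> /eqP ->] _|ne1] := boolP ((x == u) && (y == v)).
  by rewrite connect0 orbT.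
have [/andP[/eqP -> /eqP ->] _|ne2] := boolP ((x == v) && (y == u)).
  by rewrite connect0.
have del_xy : @del_edge M B u v x y by rewrite del_edgeE e_y ne1 ne2.
by case/orP => xs; apply/orP; [left | right];
  apply: connect_trans xs (connect1 del_xy).
Qed.

(** A path from one end to the other would close a cycle with the edge. *)
Lemma del_edge_disconnects u x : e x u -> ~~ connect (@del_edge M B x u) x u.
Proof.
move=> e_xu; apply/negP=> /connectP[p0 path_p0 Eu].
have [_ _ _ _ acyclic] := bd_tree B.
have sub_e : subrel (@del_edge M B x u) e by move=> a b; rewrite del_edgeE => /and3P[].
move: Eu; case: (shortenP path_p0) => p path_p uniq_p _ Eu.
case: p path_p uniq_p Eu => [|y [|z p]] path_p uniq_p Eu.
- by move: e_xu; rewrite Eu /= e_irr.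
- by move: path_p; rewrite -[y]/(last x [:: y]) -Eu /= del_edgeE !eqxx andbF.
apply: (acyclic [:: x, y, z & p]) => //; apply/andP; split=> //.
rewrite /cycle rcons_path (sub_path sub_e path_p) /=.
by rewrite -[last z p]/(last x [:: y, z & p]) -Eu e_sym.
Qed.

(** The side of [x] of an edge [xu] lies in the side of [u] of any other edge at
    [u], because it can be reached from [u] without leaving it. *)
Lemma del_edge_nested u v x z : e x u -> x != v ->
  connect (@del_edge M B x u) x z -> connect (@del_edge M B u v) u z.
Proof.
move=> e_xu ne_xv /connectP[p + ->]; elim/last_ind: p => [|p y IHp] /=.
  move=> _; apply: connect1; rewrite del_edgeE e_sym e_xu eqxx /= ne_xv /=.
  by apply/negP=> /andP[_ /eqP E]; move: e_xu; rewrite E e_irr.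
rewrite rcons_path last_rcons => /andP[path_p e_y].
have reach := IHp path_p; set a := last x p in reach e_y *.
have conn_a : connect (@del_edge M B x u) x a by apply/connectP; exists p.
have conn_y := connect_trans conn_a (connect1 e_y).
have not_u b : connect (@del_edge M B x u) x b -> b != u.
  by move=> cb; apply: contraNneq (del_edge_disconnects e_xu) => Eb; rewrite -{2}Eb.
apply: connect_trans reach (connect1 _).
have e_ay : e a y by move: e_y; rewrite del_edgeE => /and3P[].
by rewrite del_edgeE e_ay (negPf (not_u _ conn_a)) (negPf (not_u _ conn_y)) andbF.
Qed.

Lemma del_edge_branch u v z : e u v -> z != u ->
  connect (@del_edge M B u v) u z ->
  exists x, [/\ e x u, x != v & connect (@del_edge M B x u) x z].
Proof.
move=> e_uv ne_zu /connectP[p0 path_p0 Ez].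
move: Ez ne_zu; case: (shortenP path_p0) => p path_p uniq_p _ -> {z path_p0 p0}.
case: p path_p uniq_p => [|x p] /=; first by rewrite eqxx.
case/andP=> del_ux path_p /andP[uNp _] _; move: del_ux; rewrite del_edgeE => /and3P[e_ux ne1 _].
exists x; split; first by rewrite e_sym.
  by move: ne1; rewrite eqxx.
apply/connectP; exists p => //.
have /andP[ne_ux uNp'] : (u != x) && (u \notin p) by rewrite -negb_or -in_cons.
apply: (sub_in_path (P := predC1 u)) path_p.
  move=> a b /= ne_a ne_b; rewrite !del_edgeE => /and3P[-> _ _].
  by rewrite (negPf ne_a) (negPf ne_b) andbF.
apply/allP=> a; rewrite inE => /predU1P[->|ap] /=; first by rewrite eq_sym.
by apply: contraNneq uNp' => <-.
Qed.

Lemma displayed_cover (u v : V) :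
  displayed u v :|: displayed v u = [set: M] :> {set M}.
Proof.
apply/setP=> x; rewrite !inE (eq_connect (del_edgeC v u)).
exact: del_edge_sides.
Qed.

(** Among the sides that contain at least [t] elements of [W], take one with the
    least number of vertices. Its end is not a leaf, as [t > 1], so beyond it the
    side branches into two smaller sides. Each of these has fewer than [t]
    elements of [W], so at most [2t - 2] are on the chosen side. *)
Lemma balanced_edge (W : {set M}) t : 1 < t -> 3 * t <= #|W| ->
  exists u v : V, [/\ e u v, t <= #|W :&: displayed u v|
    & t <= #|W :\: displayed u v|].
Proof.
move=> t_gt1 large_W.
pose heavy (uv : V * V) := e uv.1 uv.2 && (t <= #|W :&: displayed uv.1 uv.2|).
pose side (uv : V * V) := #|[set z | connect (@del_edge M B uv.1 uv.2) uv.1 z]|.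
have [uv0 heavy0] : exists uv, heavy uv.
  have [w wW] : exists w, w \in W by apply/card_gt0P; lia.
  have [v e_v] : exists v, e (bd_leaf B w) v.
    have /bd_leafP/eqP/cards1P[v Ev] : exists x, bd_leaf B x = bd_leaf B w by exists w.
    by exists v; have := set11 v; rewrite -Ev inE.
  set u := bd_leaf B w in e_v.
  have cover : #|W| <= #|W :&: displayed u v| + #|W :&: displayed v u|.
    have [+ _] := leq_card_setU (W :&: displayed u v) (W :&: displayed v u).
    by rewrite -setIUr displayed_cover setIT.
  have [le_t|lt_t] := leqP t #|W :&: displayed u v|.
    by exists (u, v); rewrite /heavy e_v.
  by exists (v, u); rewrite /heavy /= e_sym e_v; lia.
have [[u v] /andP[/= e_uv heavy_uv] min_uv] := arg_minnP side heavy0.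
exists u, v; split=> //.
suff light : #|W :&: displayed u v| <= 2 * t - 2.
  by have := cardsID (displayed u v) W; lia.
have lighter x : e x u -> x != v -> #|W :&: displayed x u| < t.
  move=> e_xu ne_xv; rewrite ltnNge; apply/negP=> heavy_x.
  have := min_uv (x, u); rewrite /heavy /= e_xu heavy_x => /(_ isT).
  rewrite leqNgt => /negP; apply; apply: proper_card.
  apply/properP; split.
    by apply/subsetP=> z; rewrite !inE; apply: del_edge_nested.
  by exists u; rewrite !inE ?connect0 // del_edge_disconnects.
have [deg1|deg3] := bd_cubic u.
  have /bd_leafP[w Ew] := deg1.
  apply: leq_trans (_ : 1 <= _); last by lia.
  rewrite -(cards1 w); apply/subset_leq_card/subsetP=> x; rewrite !inE.
  case/andP=> _ conn_x; apply/eqP/(@bd_leaf_inj _ B); rewrite Ew; apply/eqP.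
  apply: contraTT conn_x => ne_x; apply/negP=> /(del_edge_branch e_uv ne_x)[y].
  case=> e_yu ne_yv _; move: deg1 => /eqP/cards1P[v' Ev'].
  have mem_v' z : e u z -> z = v' by move=> e_uz; apply/set1P; rewrite -Ev' inE.
  by move: ne_yv; rewrite (mem_v' v) // (mem_v' y) ?eqxx // e_sym.
have [x [y [_ Exy]]] : exists x y, x != y /\ [set z | e u z] :\ v = [set x; y].
  by apply/cards2P; have := cardsD1 v [set z | e u z]; rewrite [#|_|]deg3 inE e_uv; lia.
have nbr z : z \in [set x; y] -> e z u /\ z != v.
  by rewrite -Exy !inE e_sym => /andP[].
have [e_xu ne_xv] := nbr x (set21 x y); have [e_yu ne_yv] := nbr y (set22 x y).
have light_x := lighter x e_xu ne_xv; have light_y := lighter y e_yu ne_yv.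
apply: leq_trans (_ : #|W :&: displayed x u| + #|W :&: displayed y u| <= _); last by lia.
have [+ _] := leq_card_setU (W :&: displayed x u) (W :&: displayed y u).
apply: leq_trans; rewrite -setIUr.
apply/subset_leq_card/setIS/subsetP=> z; rewrite !inE => conn_z.
have ne_zu : bd_leaf B z != u.
  apply/eqP=> Ez; have : degree e u = 1 by apply/bd_leafP; exists z.
  by rewrite deg3.
have [x' [e_x'u ne_x'v conn_x']] := del_edge_branch e_uv ne_zu conn_z.
have : x' \in [set x; y] by rewrite -Exy !inE ne_x'v e_sym.
by rewrite !inE => /orP[]/eqP <-; rewrite conn_x' ?orbT.
Qed.

End BalancedEdge.

(** The threshold [t = b + 2] of [balanced_edge] is at least 2 and gives a
    separation of order above [b]; it needs [3t <= 2k] and [t <= k]. *)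
Lemma branch_width_window M b k :
  branch_width_at_most b M -> uniform_window M k -> k < 2 * b + 4.
Proof.
move=> bw [C [W [dCW cW iCA rk]]]; rewrite ltnNge; apply/negP=> large_k.
case: bw => [small_M|[B width_B]].
  by have := leq_trans (max_card (mem W)) small_M; rewrite cW; lia.
have [||u [v [e_uv heavy_in heavy_out]]] := @balanced_edge M B W (b + 2).
- by lia.
- by rewrite cW; lia.
have lt_lambda : b + 2 < lambda (displayed u v).
  by apply: (window_lambda dCW cW iCA rk) => //; lia.
suff le_lambda : lambda (displayed u v) <= b by lia.
apply: leq_trans width_B; rewrite /width.
exact: (@leq_bigmax_cond _ _ (fun uv => lambda (displayed uv.1 uv.2)) (u, v)).
Qed.

(** * Lattice path matroids of bounded branch-width *)

Lemma bounded_gap_dyck m r (P Q : (m + r).-tuple bool) b :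
  is_lattice_path P -> is_lattice_path Q -> never_above P Q ->
  (forall k, uniform_window (lpm P Q) k -> k < b) -> dyck b (zip P Q).
Proof.
move=> LP LQ PQ small.
have sz : size (zip P Q) = m + r by rewrite size_zip !size_tuple minnn.
have lowerE i : lower (zip P Q) i = norths P i.
  by rewrite /lower unzip1_zip // !size_tuple.
have upperE i : upper (zip P Q) i = norths Q i.
  by rewrite /upper unzip2_zip // !size_tuple.
split; [split|] => [|i _|i]; rewrite lowerE upperE.
- by rewrite /norths !take_oversize ?sz ?size_tuple // LP LQ.
- exact: PQ.
- rewrite sz => lt_i; have := small _ (lpm_window LP LQ PQ (ltnW lt_i)); lia.
Qed.

Theorem theorem1p1 (b : nat) (M : nat -> matroid)
  (M_lpm : forall i : nat, lattice_path_matroid (M i))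
  (M_bw : forall i : nat, branch_width_at_most b (M i)) :
  exists i j : nat, i < j /\ isomorphic_to_minor (M i) (M j).
Proof.
have /choice[w wP] : forall i, exists w : word, exists m r,
    exists P Q : (m + r).-tuple bool,
    [/\ w = zip P Q, is_lattice_path P, is_lattice_path Q, never_above P Q
      & isomorphic (M i) (lpm P Q)].
  move=> i; have [m [r [P [Q [LP LQ PQ iso]]]]] := M_lpm i.
  by exists (zip P Q), m, r, P, Q.
have dyck_w i : dyck (2 * b + 4) (w i).
  have [m [r [P [Q [-> LP LQ PQ iso]]]]] := wP i.
  apply: bounded_gap_dyck => // k window.
  exact: branch_width_window (M_bw i) (uniform_window_iso iso window).
have [i [j [lt_ij [f sf]]]] := wqo_dyck dyck_w.
exists i, j; split=> //.
have [m [r [P [Q [Ei LP LQ PQ iso]]]]] := wP i.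
have [m' [r' [P' [Q' [Ej LP' LQ' PQ' iso']]]]] := wP j.
rewrite Ei Ej in sf.
apply: isomorphic_to_minor_iso iso iso' _.
exact: shrinking_minor LP LQ PQ LP' LQ' PQ' _ sf.
Qed.
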